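(* Let $\mathbb{F}$ be a finite field, let $\delta,k,n$ be positive integers with $k<n$, and let $\Sigma=(A,B,C,D)$ be a linear system with $A\in\mathbb{F}^{\delta\times\delta}$, $B\in\mathbb{F}^{\delta\times k}$, $C\in\mathbb{F}^{(n-k)\times\delta}$, $D\in\mathbb{F}^{(n-k)\times k}$. The observability of $\Sigma$ is invariant under each of the following group actions, that is, $\Sigma$ is observable if and only if the transformed system is observable: (i) $\Sigma\mapsto\Sigma_1=(S^{-1}AS,\,S^{-1}B,\,CS,\,D)$, for any invertible matrix $S\in\mathbb{F}^{\delta\times\delta}$; (ii) $\Sigma\mapsto\Sigma_2=(A,\,BQ,\,C,\,DQ)$, for any invertible matrix $Q\in\mathbb{F}^{k\times k}$; (iii) $\Sigma\mapsto\Sigma_3=(A,\,B,\,H^{-1}C,\,H^{-1}D)$, for any invertible matrix $H\in\mathbb{F}^{(n-k)\times(n-k)}$.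
   Context: A linear system $(A,B,C,D)$ with $A\in\mathbb{F}^{\delta\times\delta}$, $C\in\mathbb{F}^{(n-k)\times\delta}$ is called observable if its observability matrix $\Omega_\delta(A,C)=\begin{pmatrix} C \\ C A \\ \vdots \\ C A^{\delta-1} \end{pmatrix}$ has rank $\delta$. *)

(* Defs.v *)
From mathcomp Require Import all_boot all_order all_algebra.

Set Implicit Arguments.
Unset Strict Implicit.
Unset Printing Implicit Defensive.

Import GRing.Theory.
Local Open Scope ring_scope.

(* Discrete-time system  x' = A x + B u,  y = C x + D u  acting on column
   vectors, with delta states, k inputs and p outputs. *)
Record linear_system (F : fieldType) (delta k p : nat) := LinearSystem {
  sysA : 'M[F]_delta;
  sysB : 'M[F]_(delta, k);
  sysC : 'M[F]_(p, delta);
  sysD : 'M[F]_(p, k)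
}.

(* The block column with blocks C, C A, ..., C A^(m-1). *)
Definition observability_mx (F : fieldType) (delta p m : nat)
    (A : 'M[F]_delta) (C : 'M[F]_(p, delta)) : 'M[F]_(\sum_(i < m) p, delta) :=
  \mxcol_(i < m) (C *m A ^+ i).

Definition observable (F : fieldType) (delta k p : nat)
    (Sigma : linear_system F delta k p) : Prop :=
  \rank (observability_mx delta (sysA Sigma) (sysC Sigma)) = delta.

Definition state_change (F : fieldType) (delta k p : nat) (S : 'M[F]_delta)
    (Sigma : linear_system F delta k p) : linear_system F delta k p :=
  LinearSystem (invmx S *m sysA Sigma *m S) (invmx S *m sysB Sigma)
               (sysC Sigma *m S) (sysD Sigma).

Definition input_change (F : fieldType) (delta k p : nat) (Q : 'M[F]_k)
    (Sigma : linear_system F delta k p) : linear_system F delta k p :=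
  LinearSystem (sysA Sigma) (sysB Sigma *m Q)
               (sysC Sigma) (sysD Sigma *m Q).

Definition output_change (F : fieldType) (delta k p : nat) (H : 'M[F]_p)
    (Sigma : linear_system F delta k p) : linear_system F delta k p :=
  LinearSystem (sysA Sigma) (sysB Sigma)
               (invmx H *m sysC Sigma) (invmx H *m sysD Sigma).

(* Main.v *)
Require Import Defs.
From mathcomp Require Import all_boot all_order all_algebra.

Import GRing.Theory.
Local Open Scope ring_scope.

(** Each action changes the observability matrix only by an invertible factor, so its rank stays the
    same. A state change multiplies it on the right by [S] ([observability_mx_conj]). An input
    change leaves [A] and [C], hence the matrix, untouched. An output change multiplies every block
    on the left by [invmx H]; [mxrank_observability_mx_mull], used in both directions, gives
    equality of ranks. *)

Lemma conjmx_exp (F : fieldType) (d i : nat) (S A : 'M[F]_d) :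
  S \in unitmx -> (invmx S *m A *m S) ^+ i = invmx S *m A ^+ i *m S.
Proof.
move=> uS; elim: i => [|i IHi]; first by rewrite !expr0 mulmx1 mulVmx.
by rewrite !exprSr IHi -!mulmxE !mulmxA mulmxK.
Qed.

(** In each block the [S] coming from [C *m S] cancels the leading [invmx S] of the conjugated
    power, so the trailing [S] factors out of the whole column. *)
Lemma observability_mx_conj (F : fieldType) (d p m : nat) (S A : 'M[F]_d)
    (C : 'M[F]_(p, d)) : S \in unitmx ->
  observability_mx m (invmx S *m A *m S) (C *m S) = observability_mx m A C *m S.
Proof.
move=> uS; rewrite /observability_mx mxcol_mul; apply: eq_mxcol => i.
by rewrite conjmx_exp // !mulmxA mulmxK.
Qed.

(** Acting on the outputs by [M] is left multiplication by the block diagonal matrix with [m] copies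
    of [M], which cannot raise the rank. As [M] is arbitrary, the bound serves for both [H] and its
    inverse. *)
Lemma mxrank_observability_mx_mull (F : fieldType) (d p m : nat) (A : 'M[F]_d)
    (M : 'M[F]_p) (C : 'M[F]_(p, d)) :
  (\rank (observability_mx m A (M *m C)) <= \rank (observability_mx m A C))%N.
Proof.
suff -> : observability_mx m A (M *m C)
    = (\mxdiag_(i < m) M) *m observability_mx m A C by exact: mxrankM_maxr.
rewrite /observability_mx mul_mxdiag_mxcol; apply: eq_mxcol => i.
by rewrite mulmxA.
Qed.

Theorem proposition3p4 (F : finFieldType) (delta k n : nat)
    (delta_gt0 : (0 < delta)%N) (k_gt0 : (0 < k)%N) (k_lt_n : (k < n)%N)
    (Sigma : linear_system F delta k (n - k)) :
  [/\ forall S : 'M[F]_delta, S \in unitmx ->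
        (observable Sigma <-> observable (state_change S Sigma)),
      forall Q : 'M[F]_k, Q \in unitmx ->
        (observable Sigma <-> observable (input_change Q Sigma))
    & forall H : 'M[F]_(n - k), H \in unitmx ->
        (observable Sigma <-> observable (output_change H Sigma))].
Proof.
split=> [S uS | Q _ | H uH]; rewrite /observable /=.
- by rewrite observability_mx_conj // mxrankMfree // row_free_unit.
- by [].
- suff -> : \rank (observability_mx delta (sysA Sigma) (invmx H *m sysC Sigma))
      = \rank (observability_mx delta (sysA Sigma) (sysC Sigma)) by [].
  apply/eqP; rewrite eqn_leq mxrank_observability_mx_mull /=.
  (* For the reverse inequality, write [C] as [H *m (invmx H *m C)] and take [M := H]. *)
  by rewrite -{1}(mulKVmx uH (sysC Sigma)) mxrank_observability_mx_mull.
Qed.
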